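(* $C(2,\mathbb{R}) = 2$, and $C(m,\mathbb{R}) = \frac{1}{2}\varphi(m)$ for every integer $m > 2$.
   Context: $\varphi$ is Euler's totient function. For an invertible $2\times 2$ matrix $A$, $\operatorname{Inn}_A$ denotes the map $X \mapsto A^{-1}XA$. An automorphism of $\mathrm{SL}(2,\mathbb{R})$ means an automorphism of the algebraic group $\mathrm{SL}_2$ (equivalently of $\mathrm{SL}(2,\mathbb{C})$ as an algebraic group) which leaves $\mathrm{SL}(2,\mathbb{R})$ invariant. Two automorphisms $\theta,\tau$ of $\mathrm{SL}(2,\mathbb{R})$ are isomorphic (over $\mathrm{GL}(2,\mathbb{R})$) if there is $Q \in \mathrm{GL}(2,\mathbb{R})$ such that $\tau = \operatorname{Inn}_Q^{-1}\,\theta\,\operatorname{Inn}_Q$; the equivalence classes are called isomorphy classes. $C(m,\mathbb{R})$ denotes the number of isomorphy classes of automorphisms of $\mathrm{SL}(2,\mathbb{R})$ of order (exactly) $m$. *)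

(* Defs.v *)
From HB Require Import structures.
From mathcomp Require Import all_boot all_order all_algebra.
From mathcomp Require Import finmap.
From mathcomp Require Import boolp classical_sets functions cardinality reals.
From mathcomp Require Import complex.
(* [mpoly] is not imported: its notations clash with those of [classical]. *)
From mathcomp Require mpoly.

Set Implicit Arguments.
Unset Strict Implicit.
Unset Printing Implicit Defensive.

Import GRing.Theory.
Local Open Scope classical_set_scope.
Local Open Scope ring_scope.

Section SpecialLinearGroup.
Variable F : fieldType.

Record SL2 := MkSL2 { sl2mx :> 'M[F]_2; _ : \det sl2mx == 1 }.

HB.instance Definition _ := [isSub for sl2mx].
HB.instance Definition _ := [Choice of SL2 by <:].

Lemma det_SL2 (X : SL2) : \det (X : 'M[F]_2) = 1.
Proof. by apply/eqP; case: X. Qed.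

Lemma SL2_unitmx (X : SL2) : (X : 'M[F]_2) \in unitmx.
Proof. by rewrite unitmxE det_SL2 unitr1. Qed.

Fact SL2_one_subproof : \det (1%:M : 'M[F]_2) == 1.
Proof. by rewrite det1. Qed.
Definition SL2_one := MkSL2 SL2_one_subproof.

Fact SL2_mul_subproof (X Y : SL2) : \det ((X : 'M[F]_2) *m Y) == 1.
Proof. by rewrite det_mulmx !det_SL2 mulr1. Qed.
Definition SL2_mul X Y := MkSL2 (SL2_mul_subproof X Y).

Fact SL2_inv_subproof (X : SL2) : \det (invmx (X : 'M[F]_2)) == 1.
Proof. by rewrite det_inv det_SL2 invr1. Qed.
Definition SL2_inv X := MkSL2 (SL2_inv_subproof X).

Fact SL2_mulA : associative SL2_mul.
Proof. by move=> X Y Z; apply: val_inj; rewrite /= mulmxA. Qed.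

Fact SL2_mul1g : left_id SL2_one SL2_mul.
Proof. by move=> X; apply: val_inj; rewrite /= mul1mx. Qed.

Fact SL2_mulg1 : right_id SL2_one SL2_mul.
Proof. by move=> X; apply: val_inj; rewrite /= mulmx1. Qed.

Fact SL2_mulVg : left_inverse SL2_one SL2_inv SL2_mul.
Proof. by move=> X; apply: val_inj; rewrite /= mulVmx ?SL2_unitmx. Qed.

Fact SL2_mulgV : right_inverse SL2_one SL2_inv SL2_mul.
Proof. by move=> X; apply: val_inj; rewrite /= mulmxV ?SL2_unitmx. Qed.

HB.instance Definition _ :=
  isGroup.Build SL2 SL2_mulA SL2_mul1g SL2_mulg1 SL2_mulVg SL2_mulgV.

Fact Inn_subproof (A : 'M[F]_2) (hA : A \in unitmx) (X : SL2) :
  \det (invmx A *m X *m A) == 1.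
Proof.
by rewrite !det_mulmx det_SL2 mulr1 det_inv mulVr -?unitmxE.
Qed.

Definition Inn (A : 'M[F]_2) (hA : A \in unitmx) (X : SL2) : SL2 :=
  MkSL2 (Inn_subproof hA X).

Definition InnV (A : 'M[F]_2) (hA : A \in unitmx) : SL2 -> SL2 :=
  Inn (etrans (unitmx_inv A) hA).

Lemma InnK (A : 'M[F]_2) (hA : A \in unitmx) : cancel (Inn hA) (InnV hA).
Proof.
move=> X; apply: val_inj.
by rewrite /= invmxK !mulmxA mulmxV // mul1mx -mulmxA mulmxV // mulmx1.
Qed.

Lemma InnVK (A : 'M[F]_2) (hA : A \in unitmx) : cancel (InnV hA) (Inn hA).
Proof.
move=> X; apply: val_inj.
by rewrite /= invmxK !mulmxA mulVmx // mul1mx -mulmxA mulVmx // mulmx1.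
Qed.

(* Each entry of [f X] is a polynomial in the four entries of [X]; as [SL2] is
   closed in the affine space of matrices, these are exactly the morphisms of
   varieties when [F] is algebraically closed. *)
Definition regular_map (f : SL2 -> SL2) : Prop :=
  exists P : 'I_2 -> 'I_2 -> mpoly.mpoly (2 * 2) F,
    forall (X : SL2) i j,
      (f X : 'M[F]_2) i j =
      mpoly.meval (fun k => mxvec (X : 'M[F]_2) 0 k) (P i j).

Definition algebraic_automorphism (f : SL2 -> SL2) : Prop :=
  [/\ {morph f : X Y / (X * Y)%g},
      regular_map f
    & exists g, [/\ regular_map g, cancel f g & cancel g f]].

End SpecialLinearGroup.

Section IsomorphyClasses.
Variable R : realType.
Local Notation C := R[i].

Definition SL2_real : set (SL2 C) :=
  [set X | exists A : 'M[R]_2, (X : 'M[C]_2) = map_mx (real_complex R) A].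

(* An automorphism of SL(2,R) is kept as a map on SL(2,C). *)
Definition automorphism_SL2R (theta : SL2 C -> SL2 C) : Prop :=
  algebraic_automorphism theta /\ theta @` SL2_real = SL2_real.

Definition has_order (m : nat) (theta : SL2 C -> SL2 C) : Prop :=
  [/\ (0 < m)%N, iter m theta =1 id
    & forall k, (0 < k < m)%N -> ~ (iter k theta =1 id)].

Lemma unitmx_complex (Q : 'M[R]_2) :
  Q \in unitmx -> map_mx (real_complex R) Q \in unitmx.
Proof. by rewrite map_unitmx. Qed.

Definition isomorphic_GL2R (theta tau : SL2 C -> SL2 C) : Prop :=
  exists (Q : 'M[R]_2) (hQ : Q \in unitmx),
    tau =1 InnV (unitmx_complex hQ) \o theta \o Inn (unitmx_complex hQ).

Definition isomorphy_class (theta : SL2 C -> SL2 C) : set (SL2 C -> SL2 C) :=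
  [set tau | automorphism_SL2R tau /\ isomorphic_GL2R theta tau].

Definition isomorphy_classes (m : nat) : set (set (SL2 C -> SL2 C)) :=
  [set isomorphy_class theta |
     theta in [set theta | automorphism_SL2R theta /\ has_order m theta]].

(* [fset_set] is empty on infinite sets, so this value is meaningful only when
   [isomorphy_classes m] is finite. *)
Definition num_isomorphy_classes (m : nat) : nat :=
  #|` fset_set (isomorphy_classes m)|.

End IsomorphyClasses.

Arguments isomorphy_classes R m : clear implicits.
Arguments num_isomorphy_classes R m : clear implicits.

(* Main.v *)
(** An algebraic automorphism f of SL_2 over an algebraically closed field of
    characteristic 0 is inner. On the upper unipotent matrices u(s), the trace
    of f is a polynomial in s which is constant for s <> 0, since u(s) and
    u(t^2 s) are conjugate; hence f(u(1)) is unipotent and f can be normalised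
    by f(u(1)) = u(1). Additive polynomials being linear, f(u(s)) = u(s) for
    all s; a further conjugation makes f(diag(2, 1/2)) diagonal, and then
    relations between these elements and the Weyl element w force f(w) = w.
    Since the u(s) and w generate, f is the identity.
    If Inn_A preserves SL(2,R), then A and its complex conjugate are
    proportional, so that A is a multiple of a real matrix. Non-scalar real
    2x2 matrices are classified up to conjugacy by (tr, det), so the isomorphy
    classes of nontrivial Inn_A correspond to pairs (t, D), D <> 0, up to
    (t, D) ~ (x t, x^2 D). The order of Inn_A is the order of the ratio z of
    the two eigenvalues, which is related to (t, D) by t^2 = D (2 + z + 1/z).
    For m > 2 this yields one class for each pair {z, 1/z} of primitive m-th
    roots of unity; for m = 2 we have t = 0 and the class is the sign of D. *)

Require Import Defs.
From mathcomp Require Import all_boot all_order all_algebra.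
From mathcomp Require Import classical_sets cardinality reals.
From mathcomp Require Import finmap boolp complex.
From mathcomp Require Import cyclic separable cyclotomic.
From mathcomp Require Import zify ring.

Set Implicit Arguments.
Unset Strict Implicit.
Unset Printing Implicit Defensive.

Import Order.TTheory GRing.Theory Num.Theory.
Local Open Scope classical_set_scope.
Local Open Scope ring_scope.

(** Equations are solved with an explicit multiplier [k]: after [apply], only a [ring] or [field]
    identity remains. *)
Lemma linear_combination (R : pzRingType) (k p q x y : R) :
  p = q -> x - y = k * (p - q) -> x = y.
Proof. by move=> ->; rewrite subrr mulr0 => /subr0_eq. Qed.

(** * Two-by-two matrices: normal form, conjugacy and centralisers *)

Section Matrix2.
Variable F : fieldType.
Implicit Types (a b c d x y : F) (A B : 'M[F]_2).

Definition mx2 a b c d : 'M[F]_2 :=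
  \matrix_(i, j) if i == 0 then (if j == 0 then a else b)
                 else (if j == 0 then c else d).

Lemma mx2E A : A = mx2 (A 0 0) (A 0 1) (A 1 0) (A 1 1).
Proof.
by apply/matrixP => -[[|[|[]]] //= hi] -[[|[|[]]] //= hj]; rewrite mxE /=;
  congr (A _ _); apply: val_inj.
Qed.

Lemma mx2P A : exists a b c d, A = mx2 a b c d.
Proof. by exists (A 0 0), (A 0 1), (A 1 0), (A 1 1); exact: mx2E. Qed.

Lemma mx2_inj a b c d a' b' c' d' :
  mx2 a b c d = mx2 a' b' c' d' -> [/\ a = a', b = b', c = c' & d = d'].
Proof.
by move/matrixP => e; split;
  [move: (e 0 0)|move: (e 0 1)|move: (e 1 0)|move: (e 1 1)]; rewrite !mxE.
Qed.

Lemma mul_mx2 a b c d a' b' c' d' :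
  mx2 a b c d *m mx2 a' b' c' d' =
  mx2 (a * a' + b * c') (a * b' + b * d') (c * a' + d * c') (c * b' + d * d').
Proof.
by apply/matrixP => -[[|[|[]]] //= hi] -[[|[|[]]] //= hj];
  rewrite !mxE !big_ord_recl big_ord0 !mxE /= addr0.
Qed.

Lemma add_mx2 a b c d a' b' c' d' :
  mx2 a b c d + mx2 a' b' c' d' = mx2 (a + a') (b + b') (c + c') (d + d').
Proof. by apply/matrixP => i j; rewrite !mxE; case: eqP; case: eqP. Qed.

Lemma scale_mx2 x a b c d :
  x *: mx2 a b c d = mx2 (x * a) (x * b) (x * c) (x * d).
Proof. by apply/matrixP => i j; rewrite !mxE; case: eqP; case: eqP. Qed.

Lemma scalar_mx2 a : a%:M = mx2 a 0 0 a.
Proof.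
by apply/matrixP => -[[|[|[]]] //= hi] -[[|[|[]]] //= hj];
  rewrite !mxE /=.
Qed.

Lemma det_mx2 a b c d : \det (mx2 a b c d) = a * d - b * c.
Proof.
rewrite (expand_det_row _ 0) !big_ord_recl big_ord0 /cofactor !det_mx11 !mxE /=.
by ring.
Qed.

Lemma tr_mx2 a b c d : \tr (mx2 a b c d) = a + d.
Proof. by rewrite /mxtrace !big_ord_recl big_ord0 !mxE /= addr0. Qed.

Lemma unitmx2 a b c d : (mx2 a b c d \in unitmx) = (a * d - b * c != 0).
Proof. by rewrite unitmxE det_mx2 unitfE. Qed.

(** A companion matrix of X^2 - t X + D. *)
Definition companion2 t D : 'M[F]_2 := mx2 0 1 (- D) t.

Lemma nonscalar_mx2 a b c d :
  ~~ is_scalar_mx (mx2 a b c d) = [|| b != 0, c != 0 | a != d].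
Proof.
apply/idP/idP; last first.
  apply: contraL => /is_scalar_mxP[x]; rewrite scalar_mx2.
  by move=> /mx2_inj[-> -> -> ->]; rewrite !eqxx.
apply: contraR; rewrite !negb_or !negbK => /and3P[/eqP-> /eqP-> /eqP->].
by rewrite -scalar_mx2 scalar_mx_is_scalar.
Qed.

Lemma companion2_nonscalar t D : ~~ is_scalar_mx (companion2 t D).
Proof. by rewrite nonscalar_mx2 oner_neq0. Qed.

Lemma unitmx_companion2 t D : (companion2 t D \in unitmx) = (D != 0).
Proof. by rewrite unitmx2 mul0r mul1r sub0r opprK. Qed.

Lemma tr_companion2 t D : \tr (companion2 t D) = t.
Proof. by rewrite tr_mx2 add0r. Qed.

Lemma det_companion2 t D : \det (companion2 t D) = D.
Proof. by rewrite det_mx2 mul0r mul1r sub0r opprK. Qed.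

(* The rows of P are v and v A, for a vector v which is not an eigenvector. *)
Lemma nonscalar_companion2 A : ~~ is_scalar_mx A ->
  exists2 P, P \in unitmx & P *m A = companion2 (\tr A) (\det A) *m P.
Proof.
have [a [b [c [d ->]]]] := mx2P A.
rewrite nonscalar_mx2 tr_mx2 det_mx2 => h.
have [b0|b0] := eqVneq b 0; last first.
  exists (mx2 1 0 a b); first by rewrite unitmx2 mul1r mul0r subr0.
  by rewrite !mul_mx2; congr mx2; ring.
have [c0|c0] := eqVneq c 0; last first.
  exists (mx2 0 1 c d); first by rewrite unitmx2 mul1r mul0r sub0r oppr_eq0.
  by rewrite !mul_mx2; congr mx2; ring.
move: h; rewrite b0 c0 eqxx /= => ad.
exists (mx2 1 1 a d); first by rewrite unitmx2 !mul1r subr_eq0 eq_sym.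
by rewrite !mul_mx2; congr mx2; ring.
Qed.

Lemma nonscalar_conj A B : ~~ is_scalar_mx A -> ~~ is_scalar_mx B ->
  \tr A = \tr B -> \det A = \det B ->
  exists2 Q, Q \in unitmx & Q *m A = B *m Q.
Proof.
move=> /nonscalar_companion2[P uP eP] /nonscalar_companion2[P' uP' eP'] et ed.
exists (invmx P' *m P); first by rewrite unitmx_mul unitmx_inv uP'.
rewrite -mulmxA eP et ed; apply: (can_inj (mulKmx uP')).
by rewrite mulKVmx // !mulmxA eP' -!mulmxA mulKVmx.
Qed.

Definition upper2 s : 'M[F]_2 := mx2 1 s 0 1.
Definition weyl2 : 'M[F]_2 := mx2 0 1 (- 1) 0.

Lemma det_upper2 s : \det (upper2 s) = 1.
Proof. by rewrite det_mx2; ring. Qed.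

Lemma det_weyl2 : \det weyl2 = 1.
Proof. by rewrite det_mx2; ring. Qed.

Lemma commute_upper2 A : A *m upper2 1 = upper2 1 *m A ->
  exists x y, A = mx2 x y 0 x.
Proof.
have [a [b [c [d ->]]]] := mx2P A.
rewrite !mul_mx2 => /mx2_inj[e1 e2 _ _].
have c0 : c = 0 by apply: (linear_combination (k := - 1) e1); ring.
have ad : a = d by apply: (linear_combination (k := 1) e2); ring.
by exists a, b; rewrite c0 ad.
Qed.

(** Two test matrices with integer entries suffice, so the criterion also applies when commutation
    is known only with real matrices. *)
Lemma commute_scalar A : A *m upper2 1 = upper2 1 *m A ->
  A *m weyl2 = weyl2 *m A -> is_scalar_mx A.
Proof.
move=> /commute_upper2[x [y ->]]; rewrite !mul_mx2 => /mx2_inj[e _ _ _].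
have y0 : y = 0 by apply: (linear_combination (k := - 1) e); ring.
by rewrite y0 -scalar_mx2 scalar_mx_is_scalar.
Qed.

End Matrix2.

Lemma map_mx2 (F F' : fieldType) (h : F -> F') a b c d :
  map_mx h (mx2 a b c d) = mx2 (h a) (h b) (h c) (h d).
Proof. by apply/matrixP => i j; rewrite !mxE; case: eqP; case: eqP. Qed.

(** * Polynomial endomorphisms of SL_2 over a closed field *)

Section SL2Endomorphisms.
Variable F : numClosedFieldType.
Implicit Types (g : 'M[F]_2 -> 'M[F]_2) (Q : 'M[F]_2).

(** In characteristic 0 the points n + 1 are distinct, so a nonzero difference would have too many
    roots. Starting at 1 keeps the sample points nonzero. *)
Lemma poly_eq_nat (p q : {poly F}) :
  (forall n : nat, p.[n.+1%:R] = q.[n.+1%:R]) -> p = q.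
Proof.
move=> pq; apply/subr0_eq/eqP; apply: contraT => r0.
have := @max_poly_roots _ (p - q) [seq n.+1%:R | n <- iota 0 (size (p - q)%R)] r0.
rewrite size_map size_iota ltnn; apply.
  by apply/allP => _ /mapP[n _ ->]; rewrite rootE hornerD hornerN pq subrr.
rewrite map_inj_uniq ?iota_uniq // => m n /eqP.
by rewrite eqr_nat => /eqP[].
Qed.

(* Maps on all matrices are used to avoid carrying proofs of [\det X = 1];
   only the values at matrices of determinant 1 are meaningful. *)
Record SL2_endo g : Prop := {
  SL2_endoM : forall X Y, \det X = 1 -> \det Y = 1 -> g (X *m Y) = g X *m g Y;
  SL2_endo_det : forall X, \det X = 1 -> \det (g X) = 1;
  SL2_endo_neq1 : g (upper2 1) <> 1%:M;
  SL2_endo_poly : exists P : 'M[{poly F}]_2,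
    forall s, g (upper2 s) = map_mx (horner_eval s) P }.

Lemma SL2_endo1 g : SL2_endo g -> g 1%:M = 1%:M.
Proof.
case=> gM gdet _ _; have u1 : g 1%:M \in unitmx.
  by rewrite unitmxE gdet ?det1 ?unitr1.
by apply: (can_inj (mulKmx u1)); rewrite -gM ?det1 // !mulmx1.
Qed.

Lemma SL2_endo_conj g Q : SL2_endo g -> Q \in unitmx ->
  SL2_endo (fun X => Q *m g X *m invmx Q).
Proof.
case=> gM gdet gn1 [P gP] uQ; split.
- by move=> X Y dX dY; rewrite gM // -!mulmxA mulKmx.
- move=> X dX; rewrite !det_mulmx gdet // mulr1 det_inv divrr // -unitmxE.
- move=> /(congr1 (fun M => invmx Q *m M *m Q)).
  by rewrite -!mulmxA mulKmx // mulVmx // mulmx1 mul1mx mulVmx.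
- exists (map_mx polyC Q *m P *m map_mx polyC (invmx Q)) => s.
  rewrite !map_mxM -gP -!map_mx_comp; congr (_ *m _ *m _);
  by apply/matrixP => i j; rewrite !mxE /= /horner_eval hornerC.
Qed.

Lemma SL2_endo_trace g s : SL2_endo g -> \tr (g (upper2 s)) = 2%:R.
Proof.
move=> gE; have [gM gdet _ [P gP]] := gE.
have trE x : \tr (g (upper2 x)) = (\tr P).[x].
  by rewrite gP -[RHS]/(horner_eval x _) -trace_map_mx.
have trsq t : t != 0 -> \tr (g (upper2 (t ^+ 2))) = \tr (g (upper2 1)).
  (* The torus element [h] conjugates u(1) to u(t^2). *)
  move=> t0; pose h := mx2 t 0 0 t^-1.
  have dh : \det h = 1 by rewrite det_mx2; field.
  have ugh : g h \in unitmx by rewrite unitmxE gdet ?unitr1.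
  have e : g (upper2 (t ^+ 2)) *m g h = g h *m g (upper2 1).
    rewrite -!gM ?det_upper2 //; congr g.
    by rewrite !mul_mx2; congr mx2; field.
  by rewrite -[g (upper2 (t ^+ 2))](mulmxK ugh) e mxtrace_mulC mulmxA mulVmx ?mul1mx.
have PE x : (\tr P).[x] = (\tr P).[1].
  suff -> : \tr P = (\tr P).[1]%:P by rewrite !hornerC.
  (* Each n + 1 is the square of a nonzero element, so the polynomial takes its value at 1 there. *)
  apply: poly_eq_nat => n; rewrite hornerC -!trE.
  by rewrite -(sqrtCK n.+1%:R) trsq // sqrtC_eq0 pnatr_eq0.
(* The constant is read off at s = 0, where u(0) is the identity, of trace 2. *)
rewrite trE PE -(PE 0) -trE.
have -> : upper2 (0 : F) = 1%:M by rewrite scalar_mx2.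
by rewrite SL2_endo1 // mxtrace1.
Qed.

(* An additive polynomial in characteristic 0 is linear. *)
Lemma SL2_endo_upper g : SL2_endo g -> g (upper2 1) = upper2 1 ->
  forall s, g (upper2 s) = upper2 s.
Proof.
move=> gE g1; have [gM gdet _ [P gP]] := gE.
have gu s : g (upper2 s) = upper2 (P 0 1).[s].
  (* g(u(s)) commutes with g(u(1)) = u(1), and its trace 2 then forces the diagonal entry to be
     1. *)
  have [x [y e]] : exists x y, g (upper2 s) = mx2 x y 0 x.
    apply: commute_upper2; rewrite -g1 -!gM ?det_upper2 //; congr g.
    by rewrite !mul_mx2; congr mx2; ring.
  have := SL2_endo_trace s gE; rewrite e tr_mx2 => tr2.
  have x1 : x = 1 by apply: (linear_combination (k := 2^-1) tr2); field.
  by move/matrixP: (gP s) => /(_ 0 1); rewrite e x1 !mxE /= => ->.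
have uinj s t : upper2 s = upper2 t :> 'M[F]_2 -> s = t by case/mx2_inj.
have p1 : (P 0 1).[1] = 1 by apply: uinj; rewrite -gu.
suff PX : P 0 1 = 'X by move=> s; rewrite gu PX hornerX.
apply: poly_eq_nat => n; rewrite hornerX.
elim: n => // n IHn; apply: uinj; rewrite -gu.
have -> : upper2 n.+2%:R = upper2 n.+1%:R *m upper2 1 :> 'M[F]_2.
  by rewrite mul_mx2 -[n.+2]addn1 natrD; congr mx2; ring.
by rewrite gM ?det_upper2 // !gu IHn p1.
Qed.

(** This is the Bruhat decomposition. Only products preserve [S], so the inverse of w is written as
    w^3. *)
Lemma SL2_upper_weyl_ind (S : 'M[F]_2 -> Prop) :
  (forall s, S (upper2 s)) -> S (weyl2 F) ->
  (forall X Y, \det X = 1 -> \det Y = 1 -> S X -> S Y -> S (X *m Y)) ->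
  forall X, \det X = 1 -> S X.
Proof.
move=> Su Sw SM.
have dw := det_weyl2 F; have du := @det_upper2 F.
have SMM X Y : \det X = 1 /\ S X -> \det Y = 1 /\ S Y ->
    \det (X *m Y) = 1 /\ S (X *m Y).
  by move=> [dX SX] [dY SY]; split; [rewrite det_mulmx dX dY mulr1|exact: SM].
have Sw' := conj dw Sw; have Su' s := conj (du s) (Su s).
have S3 := SMM _ _ (SMM _ _ Sw' Sw') Sw'.
have Sl X : \det X = 1 -> X 1 0 != 0 -> S X.
  have [a [b [c [d ->]]]] := mx2P X; rewrite det_mx2 mxE /= => e c0.
  (* The middle factor w u(-c) w^3 is the lower unipotent matrix with entry c. *)
  suff -> : mx2 a b c d = upper2 ((a - 1) / c) *m
     (weyl2 F *m upper2 (- c) *m (weyl2 F *m weyl2 F *m weyl2 F)) *m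
     upper2 ((d - 1) / c).
    exact: (SMM _ _ (SMM _ _ (Su' _) (SMM _ _ (SMM _ _ Sw' (Su' _)) S3)) (Su' _)).2.
  rewrite !mul_mx2; congr mx2; [by field| |by field|by field].
  by apply: (linear_combination (k := - c^-1) e); field.
move=> X dX; have [X0|] := eqVneq (X 1 0) 0; last exact: Sl.
(* For upper triangular X, the matrix w X has lower left entry -a, nonzero since a d = 1, and so
   falls under the case above. *)
have -> : X = weyl2 F *m weyl2 F *m weyl2 F *m (weyl2 F *m X).
  by rewrite [X]mx2E !mul_mx2; congr mx2; ring.
have dwX : \det (weyl2 F *m X) = 1 by rewrite det_mulmx dX mulr1.
apply: (SMM _ _ S3 (conj dwX _)).2; apply: Sl => //.
move: X0 dX; rewrite [X]mx2E det_mx2 mul_mx2 !mxE /= => ->.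
rewrite mulr0 subr0 mul0r addr0 mulN1r oppr_eq0.
by apply: contra_eq_neq => ->; rewrite mul0r eq_sym oner_neq0.
Qed.

(* With [h = diag(2, 1/2)], the relations [h w h = w] and [(w u)^3 = 1] force [g w = w]. *)
Lemma SL2_endo_id g a d : SL2_endo g -> g (upper2 1) = upper2 1 ->
  a = 4%:R * d -> g (mx2 2%:R 0 0 2%:R^-1) = mx2 a 0 0 d ->
  forall X, \det X = 1 -> g X = X.
Proof.
move=> gE g1 ad gh; have [gM gdet _ _] := gE.
set h := mx2 _ _ _ _ in gh.
have dw := det_weyl2 F.
have dh : \det h = 1 by rewrite det_mx2; field.
have := gdet _ dh; rewrite gh det_mx2 ad => d1.
have d2 : d * d = 4%:R^-1 by apply: (linear_combination (k := 4%:R^-1) d1); field.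
apply: SL2_upper_weyl_ind => [|| X Y dX dY gX gY].
- exact: SL2_endo_upper.
- have [p [q [r [s gw]]]] := mx2P (g (weyl2 F)).
  have : g h *m g (weyl2 F) *m g h = g (weyl2 F).
    rewrite -!gM // ?det_mulmx ?dh ?dw ?mulr1 //; congr g.
    by rewrite !mul_mx2; congr mx2; field.
  rewrite gh ad gw !mul_mx2 => /mx2_inj[ep _ _ es].
  (* As d^2 = 1/4 and a = 4 d, the diagonal entries of g(h) g(w) g(h) = g(w) read 4 p = p and s / 4
     = s. *)
  have p0 : p = 0.
    have e : 16%:R * (d * d) * p = p by rewrite -[RHS]ep; ring.
    by apply: (linear_combination (k := 3%:R^-1) e); rewrite d2; field.
  have s0 : s = 0.
    have e : (d * d) * s = s by rewrite -[RHS]es; ring.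
    by apply: (linear_combination (k := - 4%:R / 3%:R) e); rewrite d2; field.
  have := gdet _ dw; rewrite gw p0 s0 det_mx2 => eqr.
  have du := det_upper2 (1 : F); pose wu := weyl2 F *m upper2 1.
  have : g wu *m g wu *m g wu = 1%:M.
    rewrite -!gM ?(det_mulmx, dw, du, mulr1) //.
    rewrite -[RHS](SL2_endo1 gE); congr g.
    by rewrite /wu scalar_mx2 !mul_mx2; congr mx2; ring.
  rewrite /wu gM // g1 gw p0 s0 scalar_mx2 !mul_mx2 => /mx2_inj[er _ _ _].
  have r1 : r = - 1.
    rewrite -[r]mulr1 -[X in _ * X]eqr.
    by apply: (linear_combination (k := -1) er); ring.
  have q1 : q = 1 by apply: (linear_combination (k := 1) eqr); rewrite r1; ring.
  by rewrite q1 r1.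
- by rewrite gM // gX gY.
Qed.

Theorem SL2_endo_inner g : SL2_endo g ->
  exists2 A, A \in unitmx & forall X, \det X = 1 -> A *m g X = X *m A.
Proof.
move=> gE; have ns1 : ~~ is_scalar_mx (upper2 (1 : F)).
  by rewrite nonscalar_mx2 oner_neq0.
(* A scalar matrix of trace 2 is the identity, which [SL2_endo_neq1] excludes. *)
have nsg : ~~ is_scalar_mx (g (upper2 1)).
  apply/negP => /is_scalar_mxP[x gx].
  have := SL2_endo_trace 1 gE; rewrite gx scalar_mx2 tr_mx2 => e.
  case: (SL2_endo_neq1 gE); rewrite gx.
  by congr (_ %:M); apply: (linear_combination (k := 2%:R^-1) e); field.
have [Q uQ eQ] : exists2 Q, Q \in unitmx & Q *m g (upper2 1) = upper2 1 *m Q.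
  apply: nonscalar_conj => //; first by rewrite SL2_endo_trace // tr_mx2.
  by rewrite (SL2_endo_det gE) ?det_upper2.
have g1E := SL2_endo_conj gE uQ; set g1 := (fun X => _) in g1E.
have g11 : g1 (upper2 1) = upper2 1 by rewrite /g1 eQ mulmxK.
have g1u := SL2_endo_upper g1E g11.
pose h : 'M[F]_2 := mx2 2%:R 0 0 2%:R^-1.
have dh : \det h = 1 by rewrite det_mx2; field.
have [a [b [c [d gh]]]] := mx2P (g1 h).
have [c0 ad] : c = 0 /\ a = 4%:R * d.
  (* This is the image of h u(1) = u(4) h under [g1], which fixes every u(s). *)
  have : g1 h *m upper2 1 = upper2 4%:R *m g1 h.
    rewrite -g11 -(g1u 4%:R) -!(SL2_endoM g1E) ?det_upper2 //; congr g1.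
    by rewrite !mul_mx2; congr mx2; field.
  rewrite gh !mul_mx2 => /mx2_inj[e1 e2 _ _]; split.
    by apply: (linear_combination (k := - 4%:R^-1) e1); field.
  by apply: (linear_combination (k := 1) e2); ring.
have := SL2_endo_det g1E dh; rewrite gh det_mx2 c0 mulr0 subr0 => ad1.
have d0 : d != 0 by apply: contra_eq_neq ad1 => ->; rewrite mulr0 eq_sym oner_neq0.
(* Conjugation by u(x) turns the corner b of [g1 h] into b - x (a - d), and a - d = 3 d. It still
   fixes u(1). *)
pose U := upper2 (b / (3%:R * d)).
have uU : U \in unitmx by rewrite unitmxE det_upper2 unitr1.
have g2E := SL2_endo_conj g1E uU; set g2 := (fun X => _) in g2E.
have g21 : g2 (upper2 1) = upper2 1.
  apply: (canLR (mulmxK uU)).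
  by rewrite g11 !mul_mx2; congr mx2; ring.
have g2h : g2 h = mx2 a 0 0 d.
  apply: (canLR (mulmxK uU)).
  by rewrite gh !mul_mx2 ad c0; congr mx2; field.
exists (U *m Q); first by rewrite unitmx_mul uU.
move=> X dX; rewrite -{2}(SL2_endo_id g2E g21 ad g2h dX) /g2 /g1.
by rewrite !mulmxA !mulmxKV.
Qed.

End SL2Endomorphisms.

(** * Algebraic automorphisms are inner *)

(** Restricts a polynomial in several variables to a polynomial curve; it is applied to the curve of
    the u(s). *)
Lemma horner_mmap (F : fieldType) n (v : 'I_n -> {poly F})
    (P : mpoly.mpoly n F) s :
  (mpoly.mmap polyC v P).[s] = mpoly.meval (fun k => (v k).[s]) P.
Proof.
rewrite /mpoly.meval /mpoly.mmap.
rewrite horner_sum; apply: eq_bigr => m _; rewrite hornerM hornerC.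
by rewrite /mpoly.mmap1 horner_prod; congr (_ * _); apply: eq_bigr => i _;
  rewrite horner_exp.
Qed.

Section InnerAutomorphisms.
Import mpoly.
Variable F : fieldType.
Implicit Types (A B : 'M[F]_2) (X Y : SL2 F).

Lemma Inn_eqP A (uA : A \in unitmx) X Y :
  Y = Inn uA X <-> A *m sl2mx Y = sl2mx X *m A.
Proof.
split=> [->|e]; first by rewrite /= !mulmxA mulmxV // mul1mx.
by apply: val_inj; rewrite /= -mulmxA -e mulKmx.
Qed.

Lemma Inn_regular A (uA : A \in unitmx) : regular_map (Inn uA).
Proof.
exists (fun i j => \sum_l \sum_k (invmx A i k * A l j) *:
                  mpolyX F (mnm1 (mxvec_index k l))) => X i j.
rewrite mxE raddf_sum; apply: eq_bigr => l _.
rewrite mxE mulr_suml raddf_sum; apply: eq_bigr => k _.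
by rewrite -[RHS]/(meval _ _) mevalZ mevalXU mxvecE mulrAC.
Qed.

Lemma Inn_algebraic A (uA : A \in unitmx) : algebraic_automorphism (Inn uA).
Proof.
split; last 1 first.
- exists (InnV uA); split; [exact: Inn_regular|exact: InnK|exact: InnVK].
- move=> X Y; apply/esym/Inn_eqP; rewrite /= !mulmxA mulmxV // mul1mx.
  by rewrite mulmxK.
- exact: Inn_regular.
Qed.

End InnerAutomorphisms.

Lemma algebraic_automorphism_inner (F : numClosedFieldType) (f : SL2 F -> SL2 F) :
  algebraic_automorphism f -> exists A (uA : A \in unitmx), f =1 Inn uA.
Proof.
case=> fM [P fP] [f' [_ fK _]].
(* [g] extends f to all matrices, with the value f(1) where the determinant is not 1. *)
pose g X := sl2mx (f (insubd (SL2_one F) X)).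
have gE X (Z : SL2 F) : X = sl2mx Z -> g X = sl2mx (f Z).
  by move=> ->; rewrite /g valKd.
have sl2P X : \det X = 1 -> exists Z : SL2 F, X = sl2mx Z.
  by move=> /eqP dX; exists (MkSL2 dX).
have [|A uA gA] := @SL2_endo_inner F g; last first.
  by exists A, uA => X; apply/Inn_eqP; rewrite -gA ?det_SL2 // (gE _ X).
split.
- move=> _ _ /sl2P[X ->] /sl2P[Y ->]; rewrite (gE _ (X * Y)%g) // fM.
  by rewrite (gE _ X) // (gE _ Y).
- by move=> X _; exact: det_SL2.
- have [U eU] := sl2P _ (det_upper2 (1 : F)).
  have f1 : f 1%g = 1%g by apply: (mulgI (f 1%g)); rewrite -fM !mulg1.
  rewrite (gE _ U) // => e; have /(can_inj fK) eU1 : f U = f 1%g.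
    by rewrite f1; apply: val_inj.
  move: eU; rewrite eU1 /= scalar_mx2 => /mx2_inj[_ /eqP].
  by rewrite oner_eq0.
(* [U] is u(X) for the indeterminate X; [upper2] itself is only defined over a field. *)
- pose U : 'M[{poly F}]_2 :=
    \matrix_(i, j) if i == j then 1 else if i == 0 then 'X else 0.
  exists (\matrix_(i, j) mpoly.mmap polyC (fun k => mxvec U 0 k) (P i j)) => s.
  have [Z eZ] := sl2P _ (det_upper2 s).
  apply/matrixP => i j; rewrite (gE _ Z) // fP !mxE /horner_eval horner_mmap.
  apply: mpoly.meval_eq => k; case/mxvec_indexP: k => k l.
  rewrite !mxvecE -eZ !mxE.
  by case: k => [[|[|[]]] //= hk]; case: l => [[|[|[]]] //= hl];
    rewrite ?hornerC ?hornerX.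
Qed.

(** * Automorphisms preserving the real points *)

Section RealAutomorphisms.
Variable R : realType.
Local Notation C := R[i].
Local Notation rc := (real_complex R).
Implicit Types A B Q : 'M[R]_2.

Lemma SL2_real_mx A : \det A = 1 ->
  exists2 X : SL2 C, SL2_real X & sl2mx X = map_mx rc A.
Proof.
move=> dA; have /eqP h : \det (map_mx rc A) = 1 by rewrite det_map_mx dA rmorph1.
by exists (MkSL2 h) => //; exists A.
Qed.

Lemma Inn_complex_real A (uA : A \in unitmx) X :
  SL2_real X -> SL2_real (Inn (unitmx_complex uA) X).
Proof.
by case=> B eB; exists (invmx A *m B *m A); rewrite /= eB !map_mxM map_invmx.
Qed.

Lemma conjc_id (z : C) : z^*%C = z -> z = rc (complex.Re z).
Proof.
case: z => u v [] /eqP; rewrite eq_sym -addr_eq0 -mulr2n mulrn_eq0 /=.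
by move/eqP ->.
Qed.

Lemma automorphism_SL2RP (theta : SL2 C -> SL2 C) :
  automorphism_SL2R theta <->
  exists A (uA : A \in unitmx), theta =1 Inn (unitmx_complex uA).
Proof.
split=> [[/algebraic_automorphism_inner[A [uA thetaA]] real_theta]|]; last first.
  move=> [A [uA thetaA]].
  have -> : theta = Inn (unitmx_complex uA) by exact/funext.
  split; first exact: Inn_algebraic.
  apply/seteqP; split=> [_ [X rX <-]|X rX]; first exact: Inn_complex_real.
  exists (InnV (unitmx_complex uA) X); last exact: InnVK.
  have uA' : invmx A \in unitmx by rewrite unitmx_inv.
  have [B eB] := Inn_complex_real uA' rX; exists B; rewrite -eB /=.
  by rewrite map_invmx.
pose Ac := map_mx (@conjc R) A.
have conjrc B : map_mx (@conjc R) (map_mx rc B) = map_mx rc B.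
  by apply/matrixP => i j; rewrite !mxE conjc_real.
(* For real X, theta(X) is real too, so conjugating the entries in A theta(X) = X A gives Ac
   theta(X) = X Ac. Eliminating theta(X) shows that Ac A^-1 commutes with X. *)
have comm B : \det B = 1 ->
    Ac *m invmx A *m map_mx rc B = map_mx rc B *m (Ac *m invmx A).
  move=> /SL2_real_mx[X rX eX].
  have [B' eB'] : SL2_real (theta X) by rewrite -real_theta; exists X.
  have /Inn_eqP e := thetaA X.
  have := congr1 (map_mx (@conjc R)) e; rewrite !map_mxM eX eB' !conjrc -eB'.
  rewrite -/Ac thetaA /= eX !mulmxA => /(canRL (mulmxK uA)).
  by move=> ->; rewrite -mulmxA.
have [|x ex] := @is_scalar_mxP _ _ (Ac *m invmx A) _.
  apply: commute_scalar.
    by have := comm _ (det_upper2 1); rewrite map_mx2 rmorph0 rmorph1.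
  by have := comm _ (det_weyl2 R); rewrite map_mx2 rmorph0 rmorphN1 rmorph1.
have eAc : Ac = x *: A by rewrite -mul_scalar_mx -ex mulmxKV.
have A0 : A != 0.
  by apply: contraTneq (uA) => ->; rewrite unitmxE det0 unitr0.
have /existsP[i /existsP[j aij]] : [exists i, exists j, A i j != 0].
  apply: contraNT A0 => /existsPn h; apply/eqP/matrixP => i j; rewrite mxE.
  by have /existsPn /(_ j) := h i; rewrite negbK => /eqP.
have ca : (A i j)^*%C = x * A i j by move/matrixP: eAc => /(_ i j); rewrite !mxE.
have x0 : x != 0.
  by apply: contraNneq aij => x0; move/eqP: ca; rewrite x0 mul0r conjc_eq0.
(* Since [Ac] = x A, dividing by a nonzero entry cancels x under conjugation and makes every entry
   real. *)
pose B := (A i j)^-1 *: A.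
have [B' eB] : exists B', B = map_mx rc B'.
  exists (map_mx (@complex.Re R) B); apply/matrixP => k l.
  rewrite [RHS]mxE [X in rc X]mxE.
  apply: conjc_id.
  have : Ac k l = (x *: A) k l by rewrite eAc.
  rewrite !mxE rmorphM /= conjc_inv ca => ->.
  by field; rewrite aij x0.
have uB : B' \in unitmx.
  by rewrite -(map_unitmx rc) -eB unitmxZ // unitfE invr_eq0.
exists B', uB => X; apply/Inn_eqP; rewrite -eB -scalemxAl -scalemxAr.
by congr (_ *: _); apply/(Inn_eqP uA).
Qed.

End RealAutomorphisms.

(** * Scalar powers and the ratio of eigenvalues *)

Section PowersMatrix2.
Variable F : numClosedFieldType.
Implicit Types (A : 'M[F]_2) (la mu : F).

Lemma trace_det_roots A : exists la mu, la + mu = \tr A /\ la * mu = \det A.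
Proof.
have := sqrtCK ((\tr A) ^+ 2 - 4%:R * \det A); set s := sqrtC _ => ss.
exists ((\tr A + s) / 2%:R), ((\tr A - s) / 2%:R); split; first by field.
by apply: (linear_combination (k := - 4%:R^-1) ss); field.
Qed.

Lemma sqr_mx2 A : A *m A = \tr A *: A - (\det A)%:M.
Proof.
have [a [b [c [d ->]]]] := mx2P A.
rewrite tr_mx2 det_mx2 -scaleN1r scalar_mx2 !scale_mx2 add_mx2 mul_mx2.
by congr mx2; ring.
Qed.

(** a X + b is the remainder of X^k modulo the characteristic polynomial. The last clause is its
    derivative at a double root, multiplied by la to avoid the exponent k - 1. *)
Lemma expr_mx2 A la mu k : la + mu = \tr A -> la * mu = \det A ->
  exists a b, [/\ A ^+ k = a *: A + b%:M, la ^+ k = a * la + b,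
                  mu ^+ k = a * mu + b & la = mu -> k%:R * la ^+ k = a * la].
Proof.
move=> trA detA; elim: k => [|k [a [b [eA ela emu eeq]]]].
  exists 0, 1; rewrite !expr0 scale0r !mul0r !add0r; split=> //.
exists (a * (la + mu) + b), (- a * (la * mu)); split.
- rewrite exprSr eA -!mulmxE mulmxDl -scalemxAl sqr_mx2 -trA -detA mul_scalar_mx.
  by apply/matrixP => i j; rewrite !mxE; case: (i == j) => /=; ring.
- by rewrite exprS ela; ring.
- by rewrite exprS emu; ring.
- move=> e; rewrite exprS mulrCA -natr1 mulrDl eeq // ela -e; ring.
Qed.

(** With A^k = a A + b, scalarity means a = 0. For distinct roots a (la - mu) = la^k - mu^k; for a
    double root a la = k la^k, which is nonzero in characteristic 0. *)
Lemma expr_scalar_mx2 A la mu k : (0 < k)%N -> ~~ is_scalar_mx A ->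
  \det A != 0 -> la + mu = \tr A -> la * mu = \det A ->
  is_scalar_mx (A ^+ k) = (la != mu) && ((la / mu) ^+ k == 1).
Proof.
move=> k0 nsA dA trA detA.
have [a [b [eA ela emu eeq]]] := expr_mx2 k trA detA.
have [la0 mu0] : la != 0 /\ mu != 0 by move: dA; rewrite -detA mulf_eq0 => /norP.
have -> : is_scalar_mx (A ^+ k) = (a == 0).
  apply/idP/eqP => [/is_scalar_mxP[x ex]|a0]; last first.
    by rewrite eA a0 scale0r add0r scalar_mx_is_scalar.
  apply: contraNeq nsA => a0; apply/is_scalar_mxP; exists (a^-1 * (x - b)).
  rewrite -scale_scalar_mx -[LHS](scalerK a0); congr (_ *: _).
  by apply: (addIr b%:M); rewrite -eA ex -raddfD subrK.
rewrite expr_div_n -[X in _ && X]subr_eq0; have [e|ne] := eqVneq la mu.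
  apply/negbTE/eqP => a0; move: (eeq e) => /eqP.
  by rewrite a0 mul0r mulf_eq0 expf_eq0 pnatr_eq0 (negbTE la0) andbF orbF gtn_eqF.
have dne : la - mu != 0 by rewrite subr_eq0.
have muk0 : mu ^+ k != 0 by rewrite expf_neq0.
have -> : la ^+ k / mu ^+ k - 1 = a * ((la - mu) / mu ^+ k).
  rewrite -[X in _ - X](divff muk0) -mulrBl mulrA; congr (_ / _).
  by rewrite ela emu; ring.
by rewrite mulf_eq0 (mulf_eq0 (la - mu)) invr_eq0 (negbTE dne) (negbTE muk0) !orbF.
Qed.

End PowersMatrix2.

(** * Classification of the real inner automorphisms *)

Lemma Inn_conj (F : fieldType) (A Q : 'M[F]_2) (uA : A \in unitmx)
    (uQ : Q \in unitmx) X :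
  Q *m A *m invmx Q *m sl2mx (InnV uQ (Inn uA (Inn uQ X))) =
  sl2mx X *m (Q *m A *m invmx Q).
Proof.
have /Inn_eqP eA := erefl (Inn uA (Inn uQ X)).
have /Inn_eqP eQ := erefl (Inn uQ X).
have -> : sl2mx (InnV uQ (Inn uA (Inn uQ X))) =
    Q *m sl2mx (Inn uA (Inn uQ X)) *m invmx Q by rewrite [LHS]/= invmxK.
move: eA eQ; move: (Inn uA _) => Z; move: (Inn uQ X) => Y eA eQ.
rewrite -[Q *m Z *m _]mulmxA mulmxA mulmxKV // !mulmxA.
by rewrite -[Q *m A *m Z]mulmxA eA !mulmxA eQ.
Qed.

Section Classification.
Variable R : realType.
Local Notation C := R[i].
Local Notation rc := (real_complex R).
Implicit Types (A B Q : 'M[R]_2) (t x D : R).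

(** Made total, with value [id] at singular matrices, so that no proof of invertibility has to be
    carried. *)
Definition realInn A : SL2 C -> SL2 C :=
  if @idP (A \in unitmx) is ReflectT uA then Inn (unitmx_complex uA) else id.

Lemma realInnE A (uA : A \in unitmx) : realInn A = Inn (unitmx_complex uA).
Proof.
rewrite /realInn; case: {-}_ / idP => // uA'.
by rewrite (bool_irrelevance uA' uA).
Qed.

Lemma realInnP A X Y : A \in unitmx ->
  Y = realInn A X <->
  map_mx rc A *m sl2mx Y = sl2mx X *m map_mx rc A.
Proof. by move=> uA; rewrite (realInnE uA); exact: Inn_eqP. Qed.

Lemma automorphism_realInn theta :
  automorphism_SL2R theta <-> exists2 A, A \in unitmx & theta = realInn A.
Proof.
rewrite automorphism_SL2RP; split=> [[A [uA e]]|[A uA e]]; exists A => //.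
  by rewrite realInnE; exact/funext.
by exists uA; rewrite e realInnE.
Qed.

Lemma real_centralizer_scalar A :
  (forall X : SL2 C, SL2_real X ->
    map_mx rc A *m sl2mx X = sl2mx X *m map_mx rc A) ->
  is_scalar_mx A.
Proof.
move=> h; have hr B : \det B = 1 -> A *m B = B *m A.
  move=> /SL2_real_mx[X rX eX]; apply: (map_mx_inj (f := rc)).
  by rewrite !map_mxM -eX; exact: h.
by apply: commute_scalar; apply: hr; [exact: det_upper2|exact: det_weyl2].
Qed.

Lemma realInn_eq A B : A \in unitmx -> B \in unitmx ->
  realInn A = realInn B <-> exists2 x, x != 0 & B = x *: A.
Proof.
move=> uA uB; split=> [e|[x x0 eB]]; last first.
  apply/funext => X; apply/realInnP => //.
  have /realInnP := erefl (realInn A X) => /(_ uA) e.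
  by rewrite eB map_mxZ -scalemxAl -scalemxAr e.
have /is_scalar_mxP[x ex] : is_scalar_mx (B *m invmx A).
  apply: real_centralizer_scalar => X rX; rewrite map_mxM map_invmx.
  have /realInnP := erefl (realInn A X) => /(_ uA) eA.
  have /realInnP := erefl (realInn B X) => /(_ uB) eB.
  have uAc := unitmx_complex uA.
  rewrite -{1}[sl2mx X](mulmxK uAc) -eA -mulmxA -[_ *m _ *m invmx _]mulmxA.
  by rewrite mulKmx // mulmxA e eB mulmxA.
have eB : B = x *: A by rewrite -mul_scalar_mx -ex mulmxKV.
exists x => //; apply: contraTneq uB => x0.
by rewrite eB x0 scale0r unitmxE det0 unitr0.
Qed.

Lemma realInn_iter A k X : A \in unitmx ->
  map_mx rc (A ^+ k) *m sl2mx (iter k (realInn A) X) =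
  sl2mx X *m map_mx rc (A ^+ k).
Proof.
move=> uA; elim: k => [|k IHk]; first by rewrite expr0 map_mx1 mul1mx mulmx1.
have /realInnP := erefl (realInn A (iter k (realInn A) X)) => /(_ uA) e.
by rewrite exprSr -mulmxE map_mxM -mulmxA e mulmxA IHk mulmxA.
Qed.

Lemma realInn_iter_id A k : A \in unitmx ->
  iter k (realInn A) =1 id <-> is_scalar_mx (A ^+ k).
Proof.
move=> uA; split=> [h|/is_scalar_mxP[x ex] X].
  by apply: real_centralizer_scalar => X _; rewrite -{1}(h X) realInn_iter.
have := realInn_iter k X uA; rewrite ex map_scalar_mx -scalar_mxC.
have ux : (rc x)%:M \in @unitmx C 2.
  by rewrite -map_scalar_mx map_unitmx -ex; exact: unitrX.
by move=> e; apply: val_inj; rewrite /= -[LHS](mulmxK ux) e mulmxK.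
Qed.

Lemma has_order_realInn A m : A \in unitmx ->
  has_order m (realInn A) <->
  [/\ (0 < m)%N, is_scalar_mx (A ^+ m)
    & forall k, (0 < k < m)%N -> ~~ is_scalar_mx (A ^+ k)].
Proof.
move=> uA; split=> -[m0 /realInn_iter_id h hk]; split=> //; try exact: h.
  by move=> k /hk /realInn_iter_id h'; apply/negP => /h' -/(_ uA).
by move=> k /hk /negP h' /realInn_iter_id -/(_ uA).
Qed.

Lemma isomorphic_realInn A B : A \in unitmx -> B \in unitmx ->
  isomorphic_GL2R (realInn A) (realInn B) <->
  exists2 Q, Q \in unitmx & exists2 x, x != 0 & B *m Q = x *: (Q *m A).
Proof.
move=> uA uB; have conjE Q (uQ : Q \in unitmx) :
    InnV (unitmx_complex uQ) \o realInn A \o Inn (unitmx_complex uQ) =1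
    realInn (Q *m A *m invmx Q).
  move=> X; apply/realInnP; first by rewrite !unitmx_mul uQ uA unitmx_inv.
  rewrite (realInnE uA) !map_mxM map_invmx; exact: Inn_conj.
split=> [[Q [uQ e]]|[Q uQ [x x0 e]]].
  have /realInn_eq : realInn (Q *m A *m invmx Q) = realInn B.
    by apply/funext => X; rewrite -conjE e.
  case=> //; first by rewrite !unitmx_mul uQ uA unitmx_inv.
  by move=> x x0 ->; exists Q => //; exists x => //; rewrite -scalemxAl mulmxKV.
exists Q, uQ => X; rewrite conjE; congr (_ X).
apply/esym/realInn_eq => //; first by rewrite !unitmx_mul uQ uA unitmx_inv.
by exists x => //; rewrite scalemxAl -e mulmxK.
Qed.

Lemma isomorphic_nonscalar A B : A \in unitmx -> B \in unitmx ->
  ~~ is_scalar_mx A -> ~~ is_scalar_mx B ->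
  isomorphic_GL2R (realInn A) (realInn B) <->
  exists2 x, x != 0 & \tr B = x * \tr A /\ \det B = x ^+ 2 * \det A.
Proof.
move=> uA uB nsA nsB; rewrite isomorphic_realInn //.
split=> [[Q uQ [x x0 e]]|[x x0 [et ed]]].
  exists x => //; have -> : B = Q *m (x *: A) *m invmx Q.
    by rewrite -scalemxAr -e mulmxK.
  rewrite mxtrace_mulC mulmxA mulVmx // mul1mx mxtraceZ; split=> //.
  rewrite !det_mulmx detZ mulrAC det_inv divrr ?mul1r // -unitmxE //.
have nsxA : ~~ is_scalar_mx (x *: A).
  apply: contra nsA => /is_scalar_mxP[y ey]; apply/is_scalar_mxP.
  by exists (x^-1 * y); rewrite -scale_scalar_mx -ey scalerK.
have [||Q uQ eQ] := nonscalar_conj nsxA nsB; rewrite ?mxtraceZ ?detZ //.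
by exists Q => //; exists x; rewrite // -eQ scalemxAr.
Qed.

Lemma realInn_order_ratio A m : (1 < m)%N -> A \in unitmx ->
  has_order m (realInn A) <->
  ~~ is_scalar_mx A /\ exists2 z : C, m.-primitive_root z
    & rc (\tr A ^+ 2) = rc (\det A) * (2%:R + z + z^-1).
Proof.
move=> m1 uA; have m0 := ltnW m1; rewrite has_order_realInn //.
have [la [mu [etr edet]]] := trace_det_roots (map_mx rc A).
have dA : \det (map_mx rc A) != 0 by rewrite -unitfE -unitmxE map_unitmx.
have scE k : (0 < k)%N -> ~~ is_scalar_mx A ->
    is_scalar_mx (A ^+ k) = (la != mu) && ((la / mu) ^+ k == 1).
  move=> k0 nsA; rewrite -(map_mx_is_scalar rc) rmorphXn /=.
  by rewrite (expr_scalar_mx2 k0 _ dA etr edet) // map_mx_is_scalar.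
have [la0 mu0] : la != 0 /\ mu != 0 by move: dA; rewrite -edet mulf_eq0 => /norP.
rewrite rmorphXn /= -!(trace_map_mx, det_map_mx) -etr -edet.
split=> [[_ scm nsk]|[nsA [z prz ez]]].
  have nsA : ~~ is_scalar_mx A by rewrite -[A]expr1; exact: nsk.
  split=> //; exists (la / mu); last by field; rewrite la0 mu0.
  (* The exact order k of la / mu divides m; k < m would make A^k scalar too early. *)
  move: scm; rewrite scE // => /andP[ne /eqP /(prim_order_exists m0)[k prk dvdk]].
  have [->//|] := eqVneq m k; rewrite eq_sym => nekm.
  have k0 := prim_order_gt0 prk.
  have /nsk : (0 < k < m)%N by rewrite k0 ltn_neqAle nekm dvdn_leq.
  by rewrite scE // ne (prim_expr_order prk) eqxx.
have z0 : z != 0 by rewrite (prim_root_eq0 prz) -lt0n.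
have zV : z = la / mu \/ z^-1 = la / mu.
  (* The trace relation fixes z + 1/z only, hence z up to inversion. *)
  have : (z - la / mu) * (z^-1 - la / mu) = 0.
    by apply: (linear_combination (k := mu ^- 2) ez); field; rewrite z0 mu0.
  by move/eqP; rewrite mulf_eq0 !subr_eq0 => /orP[]/eqP; [left|right].
have ratioX k : ((la / mu) ^+ k == 1) = (m %| k)%N.
  by case: zV => <-; rewrite ?exprVn ?invr_eq1 (prim_order_dvd prz).
have ne : la != mu.
  apply/eqP => e; have := ratioX 1%N.
  by rewrite e divff // expr1 eqxx dvdn1 gtn_eqF.
split=> // [|k /andP[k0 km]]; first by rewrite scE // ne ratioX dvdnn.
by rewrite scE // ne ratioX gtnNdvd.
Qed.

End Classification.

(** * Counting the isomorphy classes *)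

Section Counting.
Variable R : realType.
Local Notation C := R[i].
Local Notation rc := (real_complex R).

Lemma eq_isomorphy_class (A B : 'M[R]_2) : A \in unitmx -> B \in unitmx ->
  isomorphy_class (realInn A) = isomorphy_class (realInn B) <->
  isomorphic_GL2R (realInn A) (realInn B).
Proof.
move=> uA uB.
have iso_refl (X : 'M[R]_2) : X \in unitmx -> isomorphic_GL2R (realInn X) (realInn X).
  move=> uX; apply/isomorphic_realInn => //.
  exists 1%:M; first exact: unitmx1.
  by exists 1; rewrite ?oner_neq0 // scale1r mul1mx mulmx1.
have iso_sub (X Y : 'M[R]_2) : X \in unitmx -> Y \in unitmx ->
    isomorphic_GL2R (realInn X) (realInn Y) ->
    isomorphy_class (realInn Y) `<=` isomorphy_class (realInn X).
  move=> uX uY /isomorphic_realInn[]// Q uQ [x x0 eQ] _ [/automorphism_realInn[Z uZ ->]].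
  move=> /isomorphic_realInn[]// P uP [y y0 eP]; split.
    by apply/automorphism_realInn; exists Z.
  apply/isomorphic_realInn => //; exists (P *m Q).
    by rewrite unitmx_mul uP.
  exists (y * x); first by rewrite mulf_neq0.
  by rewrite mulmxA eP -scalemxAl -[P *m Y *m Q]mulmxA eQ -scalemxAr scalerA mulmxA.
have iso_sym (X Y : 'M[R]_2) : X \in unitmx -> Y \in unitmx ->
    isomorphic_GL2R (realInn X) (realInn Y) ->
    isomorphic_GL2R (realInn Y) (realInn X).
  move=> uX uY /isomorphic_realInn[]// Q uQ [x x0 eQ].
  apply/isomorphic_realInn => //; exists (invmx Q); first by rewrite unitmx_inv.
  exists x^-1; first by rewrite invr_eq0.
  apply: (can_inj (mulKmx uQ)); rewrite -scalemxAr mulKVmx //.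
  have eX : Q *m X = x^-1 *: (Y *m Q) by rewrite eQ scalerK.
  by rewrite mulmxA eX -scalemxAl mulmxK.
split=> [e|iso].
  suff [] : isomorphy_class (realInn A) (realInn B) by [].
  rewrite e; split; last exact: iso_refl.
  by apply/automorphism_realInn; exists B.
by apply/seteqP; split; apply: iso_sub => //; exact: iso_sym.
Qed.

Lemma num_isomorphy_classes_reps (T : eqType) (s : seq T) (rep : T -> 'M[R]_2) m :
  uniq s -> {in s, forall k, rep k \in unitmx} ->
  {in s, forall k, has_order m (realInn (rep k))} ->
  {in s &, forall j k, isomorphic_GL2R (realInn (rep j)) (realInn (rep k)) ->
     j = k} ->
  (forall A, A \in unitmx -> has_order m (realInn A) ->
     exists2 k, k \in s & isomorphic_GL2R (realInn (rep k)) (realInn A)) ->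
  finite_set (isomorphy_classes R m) /\ num_isomorphy_classes R m = size s.
Proof.
move=> us urep orep injrep exrep.
pose cls k := isomorphy_class (realInn (rep k)).
have [F FE szF] : exists2 F : {fset set (SL2 C -> SL2 C)},
    F =i map cls s & #|` F| = size s.
  exists (seq_fset tt (map cls s)); first exact: seq_fsetE.
  rewrite [LHS]size_seq_fset undup_id ?size_map // map_inj_in_uniq // => j k js ks.
  by move=> /eq_isomorphy_class iso; apply: injrep => //; apply: iso; exact: urep.
have clsE : isomorphy_classes R m = [set` F].
  apply/seteqP; split=> [_ [theta [/automorphism_realInn[A uA ->] oA] <-]|c] /=.
    have [k ks iso] := exrep _ uA oA.
    rewrite FE; apply/mapP; exists k => //.
    by apply/esym/eq_isomorphy_class => //; exact: urep.
  rewrite FE => /mapP[k ks ->]; exists (realInn (rep k)) => //.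
  split; last exact: orep.
  by apply/automorphism_realInn; exists (rep k); rewrite ?urep.
by rewrite /num_isomorphy_classes clsE set_fsetK; split; first exact: finite_fset.
Qed.

(** X^n - 1 splits and is separable in characteristic 0; n distinct n-th roots of unity include a
    primitive one. *)
Lemma closed_prim_root_exists (F : numClosedFieldType) n : (0 < n)%N ->
  exists z : F, n.-primitive_root z.
Proof.
move=> n0; have [s] := closed_field_poly_normal ('X^n - 1 : {poly F}).
rewrite (monicP (monicXnsubC 1 n0)) scale1r => es.
have szs : size s = n.
  by apply/succn_inj; rewrite -(size_prod_XsubC s id) -es size_XnsubC.
have /hasP[z _ prz] : has n.-primitive_root s; last by exists z.
apply: has_prim_root => //; last by rewrite szs.
- by apply/allP => x; rewrite -root_prod_XsubC -es.
- by rewrite -separable_prod_XsubC -es separable_Xn_sub_1 // pnatr_eq0 -lt0n.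
Qed.

(** Roots of unity have modulus 1, so 1/z is the conjugate of z. *)
Lemma prim_root_trace_real n (z : C) : n.-primitive_root z ->
  exists t : R, rc t = 2%:R + z + z^-1.
Proof.
move=> prz; have n0 := prim_order_gt0 prz.
have z1 : `|z| = 1.
  by apply/eqP; rewrite -(pexpr_eq1 n0) // -normrX (prim_expr_order prz) normr1.
have -> : z^-1 = z^*%C by rewrite invc_norm z1 expr1n invr1 mul1r.
exists (2%:R + 2%:R * complex.Re z).
by rewrite -[RHS]addrA addcJ rmorphD rmorphM /= !rmorph_nat.
Qed.

Lemma coprime_subl k m : (k <= m)%N -> coprime (m - k) m = coprime k m.
Proof.
move=> /subnK mE.
by rewrite -[in LHS]mE addnK -[in RHS]mE /coprime gcdnDl gcdnDr gcdnC.
Qed.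

(** The involution k -> m - k preserves coprimality to m and exchanges the two halves of the
    range. *)
Lemma totient_half m : (2 < m)%N ->
  totient m =
  (size [seq k <- index_iota 1 m | coprime k m & (k.*2 < m)%N]).*2.
Proof.
move=> m2; pose F k : nat := coprime k m && (k.*2 < m)%N.
have -> : size [seq k <- index_iota 1 m | coprime k m & (k.*2 < m)%N] =
    (\sum_(1 <= k < m) F k)%N.
  by rewrite size_filter -sum1_count big_mkcond.
have FV : (\sum_(1 <= k < m) F k = \sum_(1 <= k < m) F (m - k))%N.
  by rewrite big_nat_rev; apply: eq_bigr => k _; rewrite add1n subSS.
rewrite -addnn {2}FV -big_split /= totient_count_coprime big_ltn ?(ltn_trans _ m2) //.
have -> : coprime m 0 = false by rewrite /coprime gcdn0 gtn_eqF // (ltn_trans _ m2).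
apply: eq_big_nat => k /andP[k1 km].
rewrite /F (coprime_subl (ltnW km)) coprime_sym; case ck: (coprime k m) => //=.
(* The midpoint k = m / 2 is coprime to m only when k = 1, that is m = 2. *)
have : k.*2 != m.
  apply: contraTneq ck => mE; rewrite -mE -muln2 /coprime gcdnMr.
  by apply/eqP => k1'; move: m2; rewrite -mE k1'.
by lia.
Qed.

Lemma order2_classes :
  finite_set (isomorphy_classes R 2) /\ num_isomorphy_classes R 2 = 2%N.
Proof.
pose D b : R := (-1) ^+ (b : bool).
have D0 b : D b != 0 by rewrite signr_eq0.
have N1 : (-1 == 1 :> C) = false by rewrite eq_sym -addr_eq0 -mulr2n pnatr_eq0.
have prN1 : 2.-primitive_root (-1 : C).
  apply/andP; split=> //; apply/forallP => -[[|[|[]]] //= hi].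
    by rewrite unity_rootE expr1 N1.
  by rewrite unity_rootE sqrrN expr1n !eqxx.
have order2 (A : 'M[R]_2) : A \in unitmx -> has_order 2 (realInn A) <->
    ~~ is_scalar_mx A /\ \tr A = 0.
  move=> uA; rewrite realInn_order_ratio //; split=> -[nsA h]; split=> //.
    case: h => z prz; have := prim_expr_order prz.
    move=> /eqP; rewrite sqrf_eq1 => /orP[/eqP z1|/eqP ->].
      by have := prim_order_dvd prz 1; rewrite z1 expr1n eqxx.
    rewrite invrN1 => h; apply/eqP; rewrite -sqrf_eq0; apply/eqP.
    apply: complexI.
    by rewrite h rmorph0; ring.
  exists (-1); first exact: prN1.
  by rewrite h invrN1 expr0n rmorph0; ring.
apply: (@num_isomorphy_classes_reps _ [:: true; false] (fun b => companion2 0 (D b))).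
- by [].
- by move=> b _; rewrite unitmx_companion2.
- move=> b _; apply/order2; rewrite ?unitmx_companion2 //.
  by rewrite companion2_nonscalar tr_companion2.
- move=> b c _ _ /isomorphic_nonscalar[];
    rewrite ?unitmx_companion2 ?companion2_nonscalar //.
  (* Determinants are scaled by x^2 > 0, so their sign is invariant. *)
  move=> x x0 [_]; rewrite !det_companion2 => /(congr1 Num.sg).
  have sx2 : Num.sg (x ^+ 2) = 1 by rewrite gtr0_sg // exprn_even_gt0.
  by rewrite [in RHS]sgrM sx2 mul1r !sgrX !sgrN1 => /signr_inj.
- move=> A uA /order2 []// nsA trA.
  exists (\det A < 0); first by case: (_ < 0).
  apply/isomorphic_nonscalar; rewrite ?unitmx_companion2 ?companion2_nonscalar //.
  have dA : \det A != 0 by rewrite -unitfE -unitmxE.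
  exists (Num.sqrt `|\det A|); first by rewrite sqrtr_eq0 -ltNge normr_gt0.
  rewrite tr_companion2 det_companion2 trA mulr0; split=> //.
  by rewrite sqr_sqrtr // mulrC -realEsign ?num_real.
Qed.

Lemma order_gt2_classes m : (2 < m)%N ->
  finite_set (isomorphy_classes R m) /\
  num_isomorphy_classes R m =
    size [seq k <- index_iota 1 m | coprime k m & (k.*2 < m)%N].
Proof.
move=> m2; have m1 := ltnW m2; have m0 := ltnW m1.
have [z prz] := @closed_prim_root_exists C m m0.
have z0 : z != 0 by rewrite (prim_root_eq0 prz) -lt0n.
(* The representative has trace and determinant both equal to tau, so that t^2 = D tau. [Re] loses
   nothing for k coprime to m. *)
pose tau k : R := complex.Re (2%:R + z ^+ k + z ^- k).
have tauE k : coprime k m -> rc (tau k) = 2%:R + z ^+ k + z ^- k.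
  rewrite -(prim_root_exp_coprime _ prz) => /prim_root_trace_real[t et].
  by rewrite /tau -et.
have tau0 k : coprime k m -> tau k != 0.
  move=> ck; have prk : m.-primitive_root (z ^+ k) by rewrite prim_root_exp_coprime.
  have w0 : z ^+ k != 0 by rewrite expf_neq0.
  apply: contraTneq m2 => t0.
  have e : (z ^+ k + 1) ^+ 2 = 0.
    have := tauE _ ck; rewrite t0 rmorph0 => e.
    (* tau = 0 would give (z^k + 1)^2 = 0, so z^k = -1 would have order 2, against m > 2. *)
    by apply: (linear_combination (k := - z ^+ k) e); field.
  have wN1 : z ^+ k = -1 by apply/eqP; rewrite -addr_eq0 -sqrf_eq0 e.
  rewrite -leqNgt dvdn_leq // (prim_order_dvd prk) wN1.
  by rewrite sqrrN expr1n.
apply: (@num_isomorphy_classes_reps _ _ (fun k => companion2 (tau k) (tau k))).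
- by rewrite filter_uniq // iota_uniq.
- move=> k; rewrite mem_filter => /andP[/andP[ck _] _].
  by rewrite unitmx_companion2 tau0.
- move=> k; rewrite mem_filter => /andP[/andP[ck _] _].
  apply/realInn_order_ratio; rewrite ?unitmx_companion2 ?tau0 //.
  rewrite companion2_nonscalar tr_companion2 det_companion2; split=> //.
  exists (z ^+ k); first by rewrite prim_root_exp_coprime.
  by rewrite -tauE // -rmorphM.
- move=> j k; rewrite !mem_filter => /andP[/andP[cj j2] _] /andP[/andP[ck k2] _].
  move=> /isomorphic_nonscalar[];
    rewrite ?unitmx_companion2 ?companion2_nonscalar ?tau0 //.
  move=> x x0; rewrite !tr_companion2 !det_companion2 => -[e1 e2].
  have x1 : x = 1.
    apply: (mulfI (mulf_neq0 x0 (tau0 _ cj))).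
    by rewrite mulr1 -[RHS]e1 [RHS]e2; ring.
  have := congr1 rc e1; rewrite x1 mul1r !tauE // => e.
  (* Equality of z^k + z^-k and z^j + z^-j factors this way; 0 < k + j < m excludes the second
     factor. *)
  have : (z ^+ k - z ^+ j) * (z ^+ (k + j) - 1) = 0.
    have zk0 : z ^+ k != 0 by rewrite expf_neq0.
    have zj0 : z ^+ j != 0 by rewrite expf_neq0.
    rewrite exprD.
    by apply: (linear_combination (k := z ^+ k * z ^+ j) e); field; rewrite zk0 zj0.
  move/eqP; rewrite mulf_eq0 !subr_eq0 (eq_prim_root_expr prz) -(prim_order_dvd prz).
  have k1 : (0 < k)%N.
    by rewrite lt0n; apply: contraTneq ck => ->; rewrite /coprime gcd0n gtn_eqF.
  case/orP=> [|/dvdn_leq]; last by lia.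
  by rewrite !modn_small; lia.
- move=> A uA /realInn_order_ratio[]// nsA [w prw ew].
  have [i wi] := prim_rootP prz (prim_expr_order prw).
  have ci : coprime i m by rewrite -(prim_root_exp_coprime _ prz) -wi.
  have i1 : (0 < i)%N.
    by rewrite lt0n; apply: contraTneq ci => ->; rewrite /coprime gcd0n gtn_eqF.
  have im := ltn_ord i.
  have i2 : i.*2 != m.
    apply: contraTneq ci => mE; rewrite -[X in coprime _ X]mE -muln2 /coprime gcdnMr.
    by apply/eqP; lia.
  (* One of i and m - i lies below m / 2; passing to m - i replaces w by its inverse and keeps w +
     1/w. *)
  have [k ck [km k2 wk]] : exists2 k, coprime k m &
      [/\ (0 < k < m)%N, (k.*2 < m)%N & z ^+ k = w \/ z ^+ k = w^-1].
    have [ilt|ige] := ltnP i.*2 m; first by exists i => //; split; [lia|done|left].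
    have ziV : z ^+ (m - i) = w^-1.
      by rewrite expfB // (prim_expr_order prz) mul1r wi.
    exists (m - i)%N; last by split; [lia|lia|right].
    by rewrite coprime_subl // ltnW.
  have tk : rc (tau k) = 2%:R + w + w^-1.
    rewrite tauE //; case: wk => ->; rewrite ?invrK //; ring.
  have dA : \det A != 0 by rewrite -unitfE -unitmxE.
  have e : \tr A ^+ 2 = \det A * tau k.
    by apply: complexI; rewrite ew -tk -rmorphM.
  have trA0 : \tr A != 0.
    by rewrite -sqrf_eq0 e mulf_neq0 ?tau0.
  exists k; first by rewrite mem_filter ck k2 mem_index_iota.
  apply/isomorphic_nonscalar; rewrite ?unitmx_companion2 ?companion2_nonscalar ?tau0 //.
  (* The factor is forced by the traces; the determinants then agree because (tr A)^2 = det A *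
     tau. *)
  exists (\tr A / tau k); first by rewrite mulf_neq0 ?invr_eq0 ?tau0.
  rewrite tr_companion2 det_companion2 divfK ?tau0 //; split=> //.
  by rewrite expr_div_n e; move: (tau k) (tau0 _ ck) => t t0; field.
Qed.

End Counting.

Theorem theorem7p4 (R : realType) :
  (finite_set (isomorphy_classes R 2) /\ num_isomorphy_classes R 2 = 2%N) /\
  (forall m : nat, (2 < m)%N ->
     finite_set (isomorphy_classes R m) /\
     ((num_isomorphy_classes R m)%:R = 2%:R^-1 * (totient m)%:R :> rat)%R).
Proof.
split; first exact: order2_classes.
move=> m m2; have [fin ->] := order_gt2_classes R m2; split=> //.
by rewrite totient_half // -muln2 natrM; field.
Qed.
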